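(* Let $G=N\rtimes H$ be a semidirect product of discrete groups with identity $e$, let $M$ be a normal subgroup of $N$, and let $P=\{a\in H: aMa^{-1}\subset M\}$. Assume that $H=PP^{-1}=P^{-1}P$, that $aMa^{-1}$ has finite index in $M$ for every $a\in P$, and that $\bigcap_{a\in P}aMa^{-1}=\{e\}$. In the universal $C^*$-algebra $\mathfrak{A}[N\rtimes H,M]$ with generators $s_a$ ($a\in P$) and $u(m)$ ($m\in M$), let $F$ be the set of projections in the linear span of $\{u(k)s_bs_b^*u(k)^{-1}: b\in P,\ k\in M\}$, and let $$T:=\{s_a^*u(m)fu(m')s_{a'}: m,m'\in M,\ a,a'\in P,\ f\in F\}.$$ Then $T$ is an inverse semigroup of partial isometries containing $0$. Moreover, the set of projections in $T$ coincides exactly with $F$. Also, the linear span of $T$ is a dense $*$-subalgebra of $\mathfrak{A}[N\rtimes H,M]$.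
   Context: For $a\in P$ write $M_a=aMa^{-1}$ (a normal subgroup of $M$). $\mathfrak{A}[N\rtimes H,M]$ denotes the universal (unital) $C^*$-algebra generated by isometries $\{s_a:a\in P\}$ and unitaries $\{u(m):m\in M\}$ subject to the relations: $s_as_b=s_{ab}$; $u(m)u(n)=u(mn)$; $s_au(m)=u(ama^{-1})s_a$; and, for every $a\in P$, $\sum_{k\in M/M_a}u(k)e_au(k)^{-1}=1$, where $e_a=s_as_a^*$ is the final projection of $s_a$ (the element $u(k)e_au(k)^{-1}$ depends only on the coset $kM_a$). An inverse semigroup of partial isometries in a $C^*$-algebra is a set of partial isometries closed under multiplication and under the adjoint $*$. *)

(* Defs.v *)
From HB Require Import structures.
From mathcomp Require Import all_boot all_order all_algebra.
From mathcomp Require Import complex.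
From mathcomp Require Import all_classical all_reals all_analysis.

Set Implicit Arguments.
Unset Strict Implicit.
Unset Printing Implicit Defensive.

Import Order.TTheory GRing.Theory Num.Theory.
Import numFieldNormedType.Exports.

Local Open Scope classical_set_scope.
Local Open Scope complex_scope.
Local Open Scope ring_scope.

(* No library structure joins rings and normed spaces, short of number domains,
   so the norm is a field of the algebra structure and its topology is
   carried by the alias [normed_space A].  As in [normedModType R[i]], the norm
   takes its values in R[i]; the axioms force them to be nonnegative reals. *)
HB.mixin Record isPreCStarAlgebra (R : realType) A
    of GRing.Algebra R[i] A := {
  star : A -> A ;
  cnorm : A -> R[i] ;
  starK : involutive star ;
  starD : forall x y : A, star (x + y) = star x + star y ;
  starZ : forall (c : R[i]) (x : A), star (c *: x) = Num.conj c *: star x ;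
  starM : forall x y : A, star (x * y) = star y * star x ;
  cnormD : forall x y : A, cnorm (x + y) <= cnorm x + cnorm y ;
  cnormZ : forall (c : R[i]) (x : A), cnorm (c *: x) = `|c| * cnorm x ;
  cnorm0_eq0 : forall x : A, cnorm x = 0 -> x = 0 ;
  cnormM : forall x y : A, cnorm (x * y) <= cnorm x * cnorm y ;
  cnorm_star : forall x : A, cnorm (star x * x) = cnorm x ^+ 2
}.

#[short(type="preCStarAlgType")]
HB.structure Definition PreCStarAlgebra (R : realType) :=
  {A of GRing.Algebra R[i] A & isPreCStarAlgebra R A}.

Definition normed_space (A : Type) : Type := A.

Section NormedSpace.
Variables (R : realType) (A : preCStarAlgType R).

HB.instance Definition _ := GRing.Lmodule.copy (normed_space A) A.
HB.instance Definition _ :=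
  @Lmodule_isNormed.Build R[i] (normed_space A) (@cnorm R A)
    (@cnormD R A) (@cnormZ R A) (@cnorm0_eq0 R A).

End NormedSpace.

HB.mixin Record PreCStarAlgebra_isComplete (R : realType) A
    of PreCStarAlgebra R A := {
  cstar_complete : forall F : set_system (normed_space A),
    ProperFilter F -> cauchy F -> cvg F
}.

#[short(type="cstarAlgType")]
HB.structure Definition CStarAlgebra (R : realType) :=
  {A of PreCStarAlgebra R A & PreCStarAlgebra_isComplete R A}.

HB.instance Definition _ (R : realType) (A : cstarAlgType R) :=
  Uniform_isComplete.Build (normed_space A) (@cstar_complete R A).

Section CStarVocabulary.
Variables (R : realType) (A : cstarAlgType R).
Implicit Types (x p v : A) (S : set A).

Definition is_isometry v := star v * v = 1.

Definition is_unitary_element v := star v * v = 1 /\ v * star v = 1.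

Definition is_projection p := star p = p /\ p * p = p.

Definition is_partial_isometry v := is_projection (star v * v).

Definition linear_span S : set A :=
  [set x | exists (n : nat) (c : 'I_n -> R[i]) (v : 'I_n -> A),
     (forall i, S (v i)) /\ x = \sum_(i < n) c i *: v i].

Definition is_star_subalgebra S :=
  [/\ S 0,
      forall x y, S x -> S y -> S (x + y),
      forall (c : R[i]) x, S x -> S (c *: x),
      forall x y, S x -> S y -> S (x * y)
    & forall x, S x -> S (star x)].

Definition is_inverse_semigroup S :=
  [/\ forall x, S x -> is_partial_isometry x,
      forall x y, S x -> S y -> S (x * y)
    & forall x, S x -> S (star x)].

Definition cstar_generated S :=
  forall B : set A, is_star_subalgebra B -> closed (B : set (normed_space A)) ->
    S `<=` B -> B = setT.

End CStarVocabulary.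

Section GroupVocabulary.
Variable G : groupType.
Implicit Types (N H M P X Y : set G) (a : G).

Definition is_subgroup X := group_closed (mem X).

(* X is a normal subgroup of Y. *)
Definition is_normal_subgroup X Y :=
  [/\ is_subgroup X, X `<=` Y & forall x y, X x -> Y y -> X (y * x * y^-1)%g].

(* Internal semidirect product, so that the action of H on N is conjugation. *)
Definition is_semidirect N H :=
  [/\ is_normal_subgroup N setT, is_subgroup H,
      N `&` H = [set 1%g]
    & [set (n * h)%g | n in N & h in H] = setT].

Definition conj_set a M : set G := [set (a * m * a^-1)%g | m in M].

Definition contractors H M : set G := [set a | H a /\ conj_set a M `<=` M].

(* M / X, the set of left cosets k X with k in M *)
Definition left_cosets M X : set (set G) :=
  [set [set (k * x)%g | x in X] | k in M].

Definition finite_index M X := finite_set (left_cosets M X).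

End GroupVocabulary.

Section UniversalAlgebra.
Variables (R : realType) (G : groupType) (H M : set G).

Let P := contractors H M.

(* Only the values of s on P and of u on M matter.  In the last relation the sum
   runs over the cosets K in M / M_a, each evaluated at a chosen element k of K;
   the inverse of the unitary u(k) is its adjoint. *)
Definition relations (A : cstarAlgType R) (s u : G -> A) :=
  [/\ (forall a, P a -> is_isometry (s a)) /\
      (forall m, M m -> is_unitary_element (u m)),
      forall a b, P a -> P b -> s a * s b = s (a * b)%g,
      forall m n, M m -> M n -> u m * u n = u (m * n)%g,
      forall a m, P a -> M m -> s a * u m = u (a * m * a^-1)%g * s a
    & forall a, P a ->
        \sum_(K \in left_cosets M (conj_set a M))
           (u (xget 1%g K) * (s a * star (s a)) * star (u (xget 1%g K))) = 1].

(* The morphism f is automatically unique: *-homomorphisms between C*-algebras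
   are continuous, and A is generated by the families. *)
Definition is_universal (A : cstarAlgType R) (s u : G -> A) :=
  [/\ relations s u,
      cstar_generated ([set s a | a in P] `|` [set u m | m in M])
    & forall (B : cstarAlgType R) (s' u' : G -> B), relations s' u' ->
        exists f : {lrmorphism A -> B},
          [/\ forall x, f (star x) = star (f x),
              forall a, P a -> f (s a) = s' a
            & forall m, M m -> f (u m) = u' m]].

Variables (A : cstarAlgType R) (s u : G -> A).

Definition conjugate_ranges : set A :=
  [set u k * (s b * star (s b)) * star (u k) | k in M & b in P].

Definition F_proj : set A :=
  [set f | is_projection f /\ linear_span conjugate_ranges f].

Definition T_set : set A :=
  [set t | exists a a' m m' f,
     [/\ P a /\ P a', M m /\ M m', F_proj f
       & t = star (s a) * u m * f * u m' * s a']].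

End UniversalAlgebra.

(* Main.v *)
Require Import Defs.
From HB Require Import structures.
From mathcomp Require Import all_boot all_order all_algebra.
From mathcomp Require Import complex finmap.
From mathcomp Require Import ring zify cyclic separable cyclotomic.
From mathcomp Require Import all_classical all_reals all_analysis.
Set Implicit Arguments.
Unset Strict Implicit.
Unset Printing Implicit Defensive.
Import Order.TTheory GRing.Theory Num.Theory.
Import numFieldNormedType.Exports.
Local Open Scope classical_set_scope.
Local Open Scope ring_scope.

(* The projections q k b := u(k) e_b u(k)^* with b fixed sum to 1 over M / M_b,
   hence are pairwise orthogonal: equivalently s_b^* u(k) s_b = 0 for k outside
   M_b.  Since q k b = sum_l q (k b l b^-1) (b c), and any two elements of P have
   a common right multiple, the span D of all q k b is a commutative algebra,
   stable under conjugation by u(k), s_a and s_a^*.  So F is closed under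
   products and under the same conjugations.  If c a' = d b then
   s_a' s_b^* = s_c^* e_(db) s_d, and pushing s_c^* to the left and s_d to the
   right writes a product of elements of T in the form defining T.  For t in T,
   t^* t = s_a'^* g s_a' with g in F, so t^* t is in F, and a projection t in T
   equals t^* t.

   The orthogonality rests on the positivity of x^* x, for which there is no
   spectral theory at hand.  It is replaced by the fact that 1 is an extreme
   point of the unit ball: if g = g^*, |1 + g| <= 1 and |1 - g| <= 1, then
   |1 + (w / 2) g| <= 1 for every w on the unit circle, and averaging
   w^-1 (1 + (w / 2) g)^n over the n-th roots of unity yields n |g| <= 2. *)

(** * Primitive roots of unity and their power sums *)

Lemma prim_root_exists (F : numClosedFieldType) (n : nat) :
  (0 < n)%N -> exists z : F, n.-primitive_root z.
Proof.
move=> n_gt0; have [r] := closed_field_poly_normal ('X^n - 1 : {poly F}).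
rewrite (monicP _) ?monicXnsubC // scale1r => XE.
(* [X^n - 1] is separable in characteristic 0, so it has n distinct roots, and n distinct n-th roots
   of unity include a primitive one. *)
suff /hasP[z _ z_prim] : has n.-primitive_root r by exists z.
apply: has_prim_root => //.
- by apply/allP => z; rewrite -root_prod_XsubC -XE.
- by rewrite -separable_prod_XsubC -XE separable_Xn_sub_1 // pnatr_eq0 -lt0n.
by rewrite -ltnS -(size_prod_XsubC r id) -XE size_XnsubC.
Qed.

(** Multiplying the geometric sum by [z ^+ m - 1] telescopes it to 0, and this factor is nonzero
    unless n divides m. *)
Lemma sum_expr_prim_root (F : fieldType) (n m : nat) (z : F) :
  n.-primitive_root z ->
  \sum_(j < n) (z ^+ m) ^+ j = if (n %| m)%N then n%:R else 0.
Proof.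
move=> z_prim; case: ifPn => [|]; rewrite (prim_order_dvd z_prim).
  move=> /eqP ->; under eq_bigr do rewrite expr1n.
  by rewrite sumr_const card_ord.
move=> zm1; apply: (mulfI (_ : z ^+ m - 1 != 0)); first by rewrite subr_eq0.
by rewrite mulr0 -subrX1 exprAC (prim_expr_order z_prim) expr1n subrr.
Qed.

(** * Norm estimates, and 1 as an extreme point of the unit ball *)

Section Norm.
Variables (R : realType) (A : cstarAlgType R).
Implicit Types (x y f g h p v : A) (c : R[i]).
Local Notation C := R[i].

Lemma cnorm_ge0 x : 0 <= cnorm x.
Proof. exact: (@normr_ge0 _ (normed_space A) x). Qed.

Lemma cnorm0 : cnorm (0 : A) = 0.
Proof. exact: (@normr0 _ (normed_space A)). Qed.

Lemma cnorm_sum (I : Type) (r : seq I) (Q : pred I) (f : I -> A) :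
  cnorm (\sum_(i <- r | Q i) f i) <= \sum_(i <- r | Q i) cnorm (f i).
Proof. exact: (@ler_norm_sum _ (normed_space A)). Qed.

Lemma star_inj : injective (@star R A).
Proof. exact: (inv_inj (@starK R A)). Qed.

Lemma star1 : star 1 = 1 :> A.
Proof. by rewrite -[LHS]mulr1 -[X in _ * X]starK -starM mulr1 starK. Qed.

Lemma star0 : star 0 = 0 :> A.
Proof. by apply: (addrI (star 0)); rewrite -starD !addr0. Qed.

Lemma starN x : star (- x) = - star x.
Proof. by apply: (addrI (star x)); rewrite -starD !subrr star0. Qed.

Lemma cnorm_starE x : cnorm (star x) = cnorm x.
Proof.
suff le y : cnorm y <= cnorm (star y).
  by apply/eqP; rewrite eq_le le andbT -{2}(starK x) le.
have [->|y0] := eqVneq (cnorm y) 0; first exact: cnorm_ge0.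
have y_gt0 : 0 < cnorm y by rewrite lt0r y0 cnorm_ge0.
by rewrite -(ler_pM2r y_gt0) -expr2 -cnorm_star cnormM.
Qed.

Lemma cnorm_eq0_starM x : star x * x = 0 -> x = 0.
Proof.
move=> x0; apply: (@cnorm0_eq0 R); apply/eqP.
by rewrite -sqrf_eq0 -cnorm_star x0 cnorm0.
Qed.

Lemma cnorm_le1_starM x : cnorm (star x * x) <= 1 -> cnorm x <= 1.
Proof. by rewrite cnorm_star expr_le1 ?cnorm_ge0. Qed.

Lemma cnorm_projection p : is_projection p -> cnorm p <= 1.
Proof.
move=> [sp pp]; have [->|p0] := eqVneq (cnorm p) 0; first exact: ler01.
have p_gt0 : 0 < cnorm p by rewrite lt0r p0 cnorm_ge0.
by rewrite -(ler_pM2r p_gt0) -expr2 -cnorm_star sp pp mul1r.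
Qed.

Lemma cnorm1 : cnorm (1 : A) <= 1.
Proof. by apply: cnorm_projection; split; rewrite ?star1 ?mulr1. Qed.

Lemma cnorm_isometry v : is_isometry v -> cnorm v <= 1.
Proof. by move=> v1; apply: cnorm_le1_starM; rewrite v1 cnorm1. Qed.

Lemma cnormM_le1 x y : cnorm x <= 1 -> cnorm y <= 1 -> cnorm (x * y) <= 1.
Proof.
move=> x1 y1; apply: le_trans (cnormM x y) _.
by rewrite mulr_ile1 ?cnorm_ge0.
Qed.

Lemma cnormX_le1 x n : cnorm x <= 1 -> cnorm (x ^+ n) <= 1.
Proof.
move=> x1; elim: n => [|n IH]; first by rewrite expr0 cnorm1.
by rewrite exprS cnormM_le1.
Qed.

Lemma cnorm_convex x y c : 0 <= c <= 1 -> cnorm x <= 1 -> cnorm y <= 1 ->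
  cnorm (c *: x + (1 - c) *: y) <= 1.
Proof.
move=> /andP[c0 c1] x1 y1; apply: le_trans (cnormD _ _) _.
rewrite !cnormZ (ger0_norm c0) ger0_norm ?subr_ge0 //.
rewrite -[leRHS](subrKC c) lerD //.
  by rewrite -[leRHS]mulr1 ler_wpM2l.
by rewrite -[leRHS]mulr1 ler_wpM2l ?subr_ge0.
Qed.

Lemma isometry_conj_projection v f : is_isometry v -> is_projection f ->
  is_projection (v * f * star v).
Proof.
move=> v1 [sf ff]; split; first by rewrite !starM starK sf mulrA.
by rewrite !mulrA -[_ * star v * v]mulrA v1 mulr1 -[_ * f * f]mulrA ff.
Qed.

(** 1 - 2p is a self-adjoint unitary: its square is 1. *)
Lemma cnormB_proj2 p : is_projection p -> cnorm (1 - (2 : C) *: p) <= 1.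
Proof.
move=> [sp pp]; apply: cnorm_le1_starM.
rewrite starD starN starZ star1 sp conjC_nat.
have qq : (2 *: p) * (2 *: p) = 2 *: p + 2 *: p :> A.
  by rewrite -scalerAl -scalerAr pp [X in X *: _]mulr2n scalerDl scale1r.
by rewrite mulrBl mul1r mulrBr mulr1 qq opprB addrK subrK cnorm1.
Qed.

Lemma cnorm1D_real g c : c \is Num.real -> `|c| <= 1 ->
  cnorm (1 + g) <= 1 -> cnorm (1 - g) <= 1 -> cnorm (1 + c *: g) <= 1.
Proof.
move=> cR; rewrite real_ler_norml // => /andP[c1 c2] gp gm.
have -> : 1 + c *: g = ((1 + c) / 2) *: (1 + g) + (1 - (1 + c) / 2) *: (1 - g).
  have -> : 1 - (1 + c) / 2 = (1 - c) / 2 by field.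
  rewrite !scalerDr scalerN addrACA -scalerDl -scalerBl.
  have -> : (1 + c) / 2 + (1 - c) / 2 = 1 by field.
  have -> : (1 + c) / 2 - (1 - c) / 2 = c by field.
  by rewrite scale1r.
apply: cnorm_convex => //; rewrite divr_ge0 ?ler0n //=; last first.
  by rewrite -lerBlDl sub0r.
by rewrite ler_pdivrMr ?ltr0n // mul1r [leRHS]mulr2n lerD2l.
Qed.

(* [(1 + i h)^* (1 + i h) = 1 + h^2] is the midpoint of [(1 + h)^2] and
   [(1 - h)^2]. *)
Lemma cnorm1D_imag h : star h = h -> cnorm (1 + h) <= 1 -> cnorm (1 - h) <= 1 ->
  cnorm (1 + 'i *: h) <= 1.
Proof.
move=> sh hp hm; apply: cnorm_le1_starM.
have -> : star (1 + 'i *: h) * (1 + 'i *: h) =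
    2^-1 *: (1 + h) ^+ 2 + (1 - 2^-1) *: (1 - h) ^+ 2 :> A.
  rewrite starD star1 starZ sh conjCi scaleNr.
  have -> : 1 - 2^-1 = 2^-1 :> C by field.
  rewrite mulrDl mul1r mulNr mulrDr mulr1 -scalerAl -scalerAr scalerA -expr2.
  rewrite sqrCi scaleN1r opprD opprK addrA addrK.
  rewrite -scalerDr [1 + h]addrC sqrrD1 -(opprB h 1) sqrrN sqrrB1.
  rewrite addrACA [X in X + (1 + 1)]addrACA subrr addr0.
  have -> : h ^+ 2 + h ^+ 2 + (1 + 1) = 2%:R *: (1 + h ^+ 2) :> A.
    by rewrite scaler_nat mulr2n addrACA addrC.
  by rewrite scalerA mulVf ?pnatr_eq0 // scale1r.
by apply: cnorm_convex; rewrite ?cnormX_le1 // invr_ge0 ler0n invf_le1 ?ltr0n ?ler1n.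
Qed.

(** This element is the midpoint of 1 + (Re w) h and 1 + i (Im w) h, to which the real and imaginary
    bounds apply; taking the midpoint costs the factor 1/2. *)
Lemma cnorm1D_circle h (w : C) : star h = h -> `|w| = 1 ->
  cnorm (1 + h) <= 1 -> cnorm (1 - h) <= 1 -> cnorm (1 + (w / 2) *: h) <= 1.
Proof.
move=> sh w1 hp hm.
have normRI : `|'Re w| <= 1 /\ `|'Im w| <= 1.
  have le c : `|'Re c| <= `|c| by case: (leif_normC_Re_Creal c).
  rewrite -w1; split; first exact: le.
  by have := le ('i * w); rewrite ReMil normrN normrM normCi mul1r.
have [Re1 Im1] := normRI.
have -> : 1 + (w / 2) *: h =
    2^-1 *: (1 + 'Re w *: h) + (1 - 2^-1) *: (1 + 'i *: ('Im w *: h)).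
  have -> : 1 - 2^-1 = 2^-1 :> C by field.
  rewrite !scalerDr addrACA -scalerDl !scalerA -scalerDl.
  have -> : 2^-1 + 2^-1 = 1 :> C by field.
  by rewrite scale1r {1}[w]Crect; congr (_ + _ *: _); field.
have sIm : star ('Im w *: h) = 'Im w *: h.
  by rewrite starZ sh (CrealP (Creal_Im w)).
have ImP : cnorm (1 + 'Im w *: h) <= 1 by apply: cnorm1D_real.
have ImM : cnorm (1 - 'Im w *: h) <= 1.
  by rewrite -scaleNr; apply: cnorm1D_real; rewrite ?normrN ?realN.
apply: cnorm_convex; last exact: cnorm1D_imag.
  by rewrite invr_ge0 ler0n invf_le1 ?ltr0n ?ler1n.
by apply: cnorm1D_real.
Qed.

(** Since z^(j(n-1)) = z^(-j), summing over j isolates the linear term of the binomial expansion;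
    its coefficient n, counted for n roots, gives n^2. *)
Lemma sum_binomial_prim_root (n : nat) (z : C) h :
  (1 < n)%N -> n.-primitive_root z ->
  \sum_(j < n) (z ^+ j) ^+ n.-1 *: (1 + z ^+ j *: h) ^+ n = (n ^ 2)%:R *: h.
Proof.
move=> n1 z_prim.
(* For i <= n, n - 1 + i lies between n - 1 and 2n - 1, where n is the only multiple of n once n >
   1. *)
have lin i : (i < n.+1)%N -> (n %| n.-1 + i)%N -> i = 1%N.
  by move=> ilt /dvdnP[[|[|k]] e]; [lia | lia | nia].
transitivity (\sum_(i < n.+1)
    (\sum_(j < n) (z ^+ (n.-1 + i)) ^+ j) *: (h ^+ i *+ 'C(n, i))).
  under eq_bigr do rewrite addrC exprD1n scaler_sumr.
  rewrite exchange_big /=; apply: eq_bigr => i _; rewrite scaler_suml.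
  apply: eq_bigr => j _.
  by rewrite exprZn -scalerMnr scalerA -exprD -!exprM mulnC scalerMnr.
have lt1 : (1 < n.+1)%N by apply: ltnW.
rewrite (bigD1 (Ordinal lt1)) //= [X in _ + X]big1 ?addr0 => [|i /eqP i1]; last first.
  rewrite (sum_expr_prim_root _ z_prim); case: ifP => [/lin ni|_].
    by case: i1; apply/val_inj/ni.
  by rewrite scale0r.
rewrite (sum_expr_prim_root _ z_prim) addn1 prednK ?(ltnW n1) // dvdnn.
by rewrite expr1 bin1 -[h *+ n]scaler_nat scalerA -natrM mulnn.
Qed.

Lemma cnorm1D_eq0 g : star g = g -> cnorm (1 + g) <= 1 -> cnorm (1 - g) <= 1 ->
  g = 0.
Proof.
move=> sg gp gm; apply: (@cnorm0_eq0 R).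
have bound (n : nat) : (1 < n)%N -> n%:R * cnorm g <= 2.
  move=> n1; have n0 : (0 < n)%N by apply: ltnW.
  have [z z_prim] := prim_root_exists C n0.
  have z1 j : `|z ^+ j| = 1.
    suff z1 : `|z| = 1 by rewrite normrX z1 expr1n.
    apply/eqP; rewrite -(pexpr_eq1 n0 (normr_ge0 z)).
    by rewrite -normrX (prim_expr_order z_prim) normr1.
  (* With h = g/2 each of the n summands has norm at most 1, so n^2 |g| / 2 <= n. *)
  have := sum_binomial_prim_root (2^-1 *: g) n1 z_prim.
  move=> /(congr1 (@cnorm R A)); rewrite !cnormZ normfV !normr_nat => sumE.
  have : (n ^ 2)%:R * (2^-1 * cnorm g) <= n%:R.
    rewrite -sumE; apply: le_trans (cnorm_sum _ _ _) _.
    rewrite -[n in leRHS]card_ord -sumr_const ler_sum // => j _.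
    rewrite cnormZ normrX z1 expr1n mul1r cnormX_le1 // scalerA.
    exact: cnorm1D_circle.
  rewrite -mulnn natrM -mulrA -[leRHS]mulr1 ler_pM2l ?ltr0n //.
  by rewrite mulrCA ler_pdivrMl ?ltr0n // mulr1.
(* The norm takes values in [R[i]]; it is moved to [R], whose Archimedean property contradicts n |g|
   <= 2 for large n if |g| > 0. *)
have [r re] : exists r : R, cnorm g = r%:C%C.
  by apply/complex_realP; rewrite ger0_real ?cnorm_ge0.
have r0 : 0 <= r by rewrite -lecR -re cnorm_ge0.
rewrite re; congr (_ %:C%C); apply/eqP; rewrite eq_le r0 andbT leNgt; apply/negP => r_gt0.
have := Num.Theory.archi_boundP (divr_ge0 (ler0n R 2) r0).
set n := Num.bound _ => nlt.
(* [n.+2] still exceeds 2/r and is greater than 1, as [bound] demands. *)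
have := bound n.+2 isT; rewrite re -(rmorph_nat (real_complex R)) -rmorphM /=.
rewrite -(rmorph_nat (real_complex R) 2) lecR leNgt -ltr_pdivrMr //.
by rewrite (lt_trans nlt) // ltr_nat.
Qed.

(** The bound |1 - 2 h_i| <= 1 stands in for 0 <= h_i <= 1. With n = #|I| and g = (2/n) h_i, n (1 -
    g) is 1 - 2 h_i plus n - 1 copies of 1; as the h_j sum to 0, n (1 + g) is 1 plus the sum of the
    1 - 2 h_j over j != i. So 1 + g and 1 - g have norm at most 1, and extremality gives g = 0. *)
Lemma sum_eq0_cnormB_le1 (I : finType) (h : I -> A) :
  (forall i, star (h i) = h i) -> (forall i, cnorm (1 - 2 *: h i) <= 1) ->
  \sum_i h i = 0 -> forall i, h i = 0.
Proof.
move=> sh h1 sum0 i.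
have n_gt0 : (0 < #|I|)%N by apply/card_gt0P; exists i.
pose m : C := #|I|%:R.
have m_gt0 : 0 < m by rewrite ltr0n.
have sumh (J : pred I) : cnorm (\sum_(j | J j) (1 - 2 *: h j)) <= #|J|%:R.
  apply: le_trans (cnorm_sum _ _ _) _.
  by rewrite -sumr_const ler_sum.
have mV x : cnorm x <= m -> cnorm (m^-1 *: x) <= 1.
  by move=> xm; rewrite cnormZ ger0_norm ?invr_ge0 ?(ltW m_gt0) // ler_pdivrMl // mulr1.
have sumNi : \sum_(j | j != i) h j = - h i.
  by apply/eqP; rewrite -addr_eq0 addrC -(bigD1 i (P := predT)) //= sum0.
suff : m^-1 *: (2 *: h i) = 0.
  move=> /(congr1 (fun x => 2^-1 *: (m *: x))).
  by rewrite !scaler0 [m *: _]scalerA mulfV ?gt_eqF // scale1r scalerA mulVf ?pnatr_eq0 // scale1r.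
have mU : m^-1 *: m%:A = 1 :> A by rewrite scalerA mulVf ?gt_eqF // scale1r.
apply: cnorm1D_eq0.
- by rewrite !starZ sh conjC_nat fmorphV /= conjC_nat.
- rewrite -mU -scalerDr; apply: mV.
  have -> : m%:A + 2 *: h i = \sum_(j | j != i) (1 - 2 *: h j) + 1.
    rewrite sumrB sumr_const -scaler_sumr sumNi scalerN opprK addrAC; congr (_ + _).
    by rewrite -mulrSr cardC1 prednK // scaler_nat.
  apply: le_trans (cnormD _ _) _.
  rewrite (_ : m = #|predC1 i|%:R + 1) ?lerD ?cnorm1 ?sumh //.
  by rewrite cardC1 natr1 prednK.
rewrite -mU -scalerBr; apply: mV.
have -> : m%:A - 2 *: h i = 1 *+ #|predC1 i| + (1 - 2 *: h i).
  by rewrite addrA -mulrSr cardC1 prednK // [m%:A]scaler_nat.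
apply: le_trans (cnormD _ _) _.
rewrite (_ : m = #|predC1 i|%:R + 1) ?lerD ?h1 //; last by rewrite cardC1 natr1 prednK.
rewrite -!sumr_const; apply: le_trans (cnorm_sum _ _ _) _.
by apply: ler_sum => j _; exact: cnorm1.
Qed.

End Norm.

(** * Linear spans and their stability under products and adjoints *)

Section LinearSpan.
Variables (R : realType) (A : cstarAlgType R).
Implicit Types (S B : set A).

Lemma linear_span_gen S x : S x -> linear_span S x.
Proof.
move=> Sx; exists 1%N, (fun=> 1), (fun=> x); split=> //.
by rewrite big_ord1 scale1r.
Qed.

Lemma linear_span0 S : linear_span S 0.
Proof.
exists 0%N, (fun=> 0), (fun=> 0); split=> [[]//|].
by rewrite big_ord0.
Qed.

Lemma linear_spanZ S c x : linear_span S x -> linear_span S (c *: x).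
Proof.
move=> [n [d [v [Sv ->]]]]; exists n, (fun i => c * d i), v; split=> //.
by rewrite scaler_sumr; apply: eq_bigr => i _; rewrite scalerA.
Qed.

Lemma linear_spanD S x y :
  linear_span S x -> linear_span S y -> linear_span S (x + y).
Proof.
move=> [n [d [v [Sv ->]]]] [m [d' [v' [Sv' ->]]]].
exists (n + m)%N, (fun i : 'I_(n + m) => match fintype.split i with inl j => d j | inr j => d' j end),
  (fun i : 'I_(n + m) => match fintype.split i with inl j => v j | inr j => v' j end).
split=> [i|]; first by case: fintype.split.
rewrite big_split_ord; congr (_ + _); apply: eq_bigr => i _.
  by rewrite (unsplitK (inl i)).
by rewrite (unsplitK (inr i)).
Qed.

Lemma linear_span_sum S (I : finType) (f : I -> A) :
  (forall i, linear_span S (f i)) -> linear_span S (\sum_i f i).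
Proof.
move=> Sf; apply: big_ind => //; first exact: linear_span0.
exact: linear_spanD.
Qed.

Lemma linear_span_sub S B : B 0 -> (forall x y, B x -> B y -> B (x + y)) ->
  (forall (c : R[i]) x, B x -> B (c *: x)) -> S `<=` B -> linear_span S `<=` B.
Proof.
move=> B0 BD BZ SB _ [n [c [v [Sv ->]]]].
by apply: big_ind => // i _; apply/BZ/SB.
Qed.

(** Covers conjugations and, with a or b equal to 1, one-sided multiplications; [linear_spanM] uses
    it once per factor. *)
Lemma linear_span_sandwich S B a b :
  (forall x, S x -> linear_span B (a * x * b)) ->
  forall x, linear_span S x -> linear_span B (a * x * b).
Proof.
move=> Sf; apply: linear_span_sub => [|x y Bx By|c x Bx|]; last exact: Sf.
- by rewrite mulr0 mul0r; exact: linear_span0.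
- by rewrite mulrDr mulrDl; exact: linear_spanD.
by rewrite -scalerAr -scalerAl; exact: linear_spanZ.
Qed.

Lemma linear_spanM S S' B : (forall x y, S x -> S' y -> linear_span B (x * y)) ->
  forall x y, linear_span S x -> linear_span S' y -> linear_span B (x * y).
Proof.
move=> SB x y Sx S'y; rewrite -[y]mulr1 mulrA.
apply: linear_span_sandwich S'y => {}y S'y; rewrite mulr1 -[x]mul1r.
by apply: linear_span_sandwich Sx => {}x Sx; rewrite mul1r; exact: SB.
Qed.

Lemma linear_span_comm S S' : (forall x y, S x -> S' y -> x * y = y * x) ->
  forall x y, linear_span S x -> linear_span S' y -> x * y = y * x.
Proof.
have comm_span B x : (forall y, B y -> x * y = y * x) ->
    forall y, linear_span B y -> x * y = y * x.
  move=> Bx; apply: linear_span_sub => [|y z yx zx|c y yx|//].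
  - by rewrite mulr0 mul0r.
  - by rewrite mulrDr mulrDl yx zx.
  by rewrite -scalerAr -scalerAl yx.
move=> SB x y Sx; apply: (comm_span) => {}y S'y; apply/esym.
by move: x Sx; apply: (comm_span) => x Sx; apply/esym/SB.
Qed.

Lemma linear_span_star_subalgebra S : (forall x y, S x -> S y -> S (x * y)) ->
  (forall x, S x -> S (star x)) -> is_star_subalgebra (linear_span S).
Proof.
move=> SM Sstar; split.
- exact: linear_span0.
- exact: linear_spanD.
- exact: linear_spanZ.
- by apply: linear_spanM => x y Sx Sy; apply/linear_span_gen/SM.
apply: linear_span_sub => [|x y|c x|x Sx].
- by rewrite star0; exact: linear_span0.
- by rewrite starD; exact: linear_spanD.
- by rewrite starZ; exact: linear_spanZ.
by apply/linear_span_gen/Sstar.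
Qed.

End LinearSpan.

(** * The groups M and H, the semigroup P and its common multiples *)

Section Algebra.
Variables (R : realType) (G : groupType) (H M : set G).
Variables (A : cstarAlgType R) (s u : G -> A).
Let P := contractors H M.
Hypotheses (subH : is_subgroup H) (subM : is_subgroup M).
Hypotheses (hHr : H = [set (a * b^-1)%g | a in P & b in P])
  (hHl : H = [set (a^-1 * b)%g | a in P & b in P]).
Hypotheses (hfin : forall a, P a -> finite_index M (conj_set a M))
  (rel : relations H M s u).
Local Notation D := (linear_span (conjugate_ranges H M s u)).
Local Notation F := (F_proj H M s u).

Local Lemma M1 : M 1%g.
Proof. by case: subM; rewrite inE. Qed.

Local Lemma MV k : M k -> M k^-1%g.
Proof. by move=> Mk; have := group_closedV subM; move/(_ k); rewrite !inE; apply. Qed.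

Local Lemma MM k l : M k -> M l -> M (k * l)%g.
Proof. by move=> Mk Ml; have := group_closedM subM; move/(_ k l); rewrite !inE; apply. Qed.

Local Lemma HM a b : H a -> H b -> H (a * b)%g.
Proof. by move=> Ha Hb; have := group_closedM subH; move/(_ a b); rewrite !inE; apply. Qed.

Local Lemma HV a : H a -> H a^-1%g.
Proof. by move=> Ha; have := group_closedV subH; move/(_ a); rewrite !inE; apply. Qed.

Local Lemma P1 : P 1%g.
Proof.
split; first by case: subH; rewrite inE.
by move=> _ [m Mm <-]; rewrite mul1g invg1 mulg1.
Qed.

Local Lemma PJ a m : P a -> M m -> M (a * m * a^-1)%g.
Proof. by move=> [_ aM] Mm; apply: aM; exists m. Qed.

Local Lemma PM a b : P a -> P b -> P (a * b)%g.
Proof.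
move=> Pa Pb; split; first by apply: HM; [case: Pa | case: Pb].
move=> _ [m Mm <-].
rewrite (_ : (a * b * m * (a * b)^-1)%g = (a * (b * m * b^-1) * a^-1)%g).
  by apply: PJ => //; apply: PJ.
by rewrite invgM !mulgA.
Qed.

(** The Ore condition contained in H = P^{-1} P: write a b^{-1} as c^{-1} d. *)
Local Lemma left_multiple a b : P a -> P b ->
  exists c d, [/\ P c, P d & (c * a)%g = (d * b)%g].
Proof.
move=> [Ha _] [Hb _]; have : H (a * b^-1)%g by apply: HM => //; apply: HV.
rewrite hHl => -[c Pc [d Pd cd]]; exists c, d; split=> //.
by apply: (mulIg b^-1%g); rewrite mulgK -mulgA -cd mulVKg.
Qed.

Local Lemma right_multiple a b : P a -> P b ->
  exists c d, [/\ P c, P d & (a * c)%g = (b * d)%g].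
Proof.
move=> [Ha _] [Hb _]; have : H (a^-1 * b)%g by apply: HM => //; apply: HV.
rewrite hHr => -[c Pc [d Pd cd]]; exists c, d; split=> //.
by apply: (mulgI a^-1%g); rewrite mulKg mulgA -cd mulgVK.
Qed.

(** * First consequences of the relations *)

Local Lemma sK a : P a -> star (s a) * s a = 1.
Proof. by case: rel => -[+ _] _ _ _ _; apply. Qed.

Local Lemma uK m : M m -> star (u m) * u m = 1.
Proof. by case: rel => -[_ +] _ _ _ _ => /[apply] -[]. Qed.

Local Lemma uKV m : M m -> u m * star (u m) = 1.
Proof. by case: rel => -[_ +] _ _ _ _ => /[apply] -[]. Qed.

Local Lemma sM a b : P a -> P b -> s (a * b)%g = s a * s b.
Proof. by case: rel => _ + _ _ _ => sM Pa Pb; rewrite sM. Qed.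

Local Lemma uM k l : M k -> M l -> u (k * l)%g = u k * u l.
Proof. by case: rel => _ _ + _ _ => uM Mk Ml; rewrite uM. Qed.

Local Lemma su a m : P a -> M m -> s a * u m = u (a * m * a^-1)%g * s a.
Proof. by case: rel => _ _ _ + _; apply. Qed.

Local Lemma u1 : u 1%g = 1.
Proof. by rewrite -[LHS]mul1r -(uK M1) -mulrA -uM ?mul1g //; exact: M1. Qed.

Local Lemma s1 : s 1%g = 1.
Proof. by rewrite -[LHS]mul1r -(sK P1) -mulrA -sM ?mul1g //; exact: P1. Qed.

Local Lemma uV m : M m -> u m^-1%g = star (u m).
Proof.
move=> Mm; rewrite -[LHS]mulr1 -(uKV Mm) mulrA -uM ?mulVg ?u1 ?mul1r //.
exact: MV.
Qed.

Local Lemma us a m : P a -> M m ->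
  u m * star (s a) = star (s a) * u (a * m * a^-1)%g.
Proof.
move=> Pa Mm; apply: star_inj; rewrite !starM !starK -!uV //; last exact: PJ.
by rewrite su //; [rewrite !invgM invgK mulgA | exact: MV].
Qed.

(** * Range projections of the isometries u(k) s_b, and their orthogonality for fixed b *)

Definition range_conj k b := u k * (s b * star (s b)) * star (u k).
Local Notation q := range_conj.

Local Lemma u_q k l b : M k -> M l -> u k * q l b * star (u k) = q (k * l)%g b.
Proof. by move=> Mk Ml; rewrite /q uM // starM !mulrA. Qed.

Local Lemma s_q a l b : P a -> P b -> M l ->
  s a * q l b * star (s a) = q (a * l * a^-1)%g (a * b)%g.
Proof.
move=> Pa Pb Ml; rewrite /q sM // starM !mulrA su //.
rewrite -[_ * star (u l) * _]mulrA -uV // us //; last exact: MV.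
rewrite (_ : (a * l^-1 * a^-1)%g = (a * l * a^-1)^-1%g).
  by rewrite uV ?mulrA //; exact: PJ.
by rewrite !invgM invgK mulgA.
Qed.

Local Lemma q_proj k b : M k -> P b -> is_projection (q k b).
Proof.
move=> Mk Pb; split; first by rewrite /q !starM !starK !mulrA.
rewrite /q !mulrA -[_ * star (u k) * u k]mulrA uK // mulr1.
by rewrite -[_ * star (s b) * s b]mulrA sK // mulr1.
Qed.

Local Lemma q_unit m : M m -> q m 1%g = 1.
Proof. by move=> Mm; rewrite /q s1 star1 !mulr1 uKV. Qed.

(** For l = k a m a^{-1}, u(a m a^{-1}) passes through s_a as u(m), which cancels against its
    adjoint. *)
Local Lemma q_coset a k l :
  P a -> M k -> conj_set a M (k^-1 * l)%g -> q l a = q k a.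
Proof.
move=> Pa Mk [m Mm ml].
have -> : l = (k * (a * m * a^-1))%g by rewrite ml mulVKg.
rewrite -u_q //; last exact: PJ.
by have := s_q Pa P1 Mm; rewrite mulg1 q_unit // mulr1 => <-.
Qed.

(** The last defining relation, indexed by a finite type with chosen representatives; the third
    clause says that every coset k M_a is represented. *)
Local Lemma partition a : P a -> exists (I : finType) (kappa : I -> G),
  [/\ forall i, M (kappa i), \sum_i q (kappa i) a = 1
    & forall k, M k -> exists i, conj_set a M (k^-1 * kappa i)%g].
Proof.
move=> Pa; pose L := left_cosets M (conj_set a M).
have Lfin : finite_set L by exact: hfin.
have LI (K : fset_set L) : L (val K).
  by have := valP K; rewrite in_fset_set // inE.
have LM K : L K -> M (xget 1%g K) /\ K (xget 1%g K).
  move=> [k Mk kK]; have Kx : K (xget 1%g K).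
    by apply: (@xgetPex _ 1%g); exists k; rewrite -kK; exists 1%g;
      [exists 1%g; [exact: M1 | rewrite mulg1 mulgV] | rewrite mulg1].
  split=> //; move: Kx; rewrite -{1}kK => -[_ [m Mm <-] <-].
  by apply: MM => //; exact: PJ.
exists (fset_set L), (fun K => xget 1%g (val K)); split.
- by move=> K; case: (LM _ (LI K)).
- case: rel => _ _ _ _ /(_ a Pa); rewrite -/P -/L => <-.
  by rewrite fsbig_finite // big_seq_fsetE.
move=> k Mk; have Lk : L [set (k * x)%g | x in conj_set a M] by exists k.
have kI : [set (k * x)%g | x in conj_set a M] \in fset_set L.
  by rewrite in_fset_set // inE.
exists [` kI]%fset; have [_ [x aMx /= <-]] := LM _ Lk.
by rewrite mulKg.
Qed.

(** Compress the partition of unity by s_a: the h_j = s_a^* q_j s_a sum to 1, and the one at the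
    coset of 1 is already 1, so the others sum to 0 and hence vanish. At the coset of k, h_j = x x^*
    with x = s_a^* u(k) s_a, so x = 0. *)
Local Lemma s_u_s a k : P a -> M k -> ~ conj_set a M k ->
  star (s a) * u k * s a = 0.
Proof.
move=> Pa Mk kNa; have [I [kappa [Mkap sumq repr]]] := partition Pa.
have [i0 ki0] := repr _ M1; have [i ki] := repr _ Mk.
pose h j := star (s a) * q (kappa j) a * s a.
have sqs1 : h i0 = 1.
  rewrite /h (q_coset Pa M1 ki0) /q u1 star1 mul1r mulr1.
  by rewrite mulrA sK // mul1r sK.
(* The term at [i0] is replaced by 0, so that the whole family sums to 0. *)
have h0 : forall j, (if j == i0 then 0 else h j) = 0.
  apply: sum_eq0_cnormB_le1 => [j|j|].
  - case: eqP => _; first by rewrite star0.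
    have [qstar _] := q_proj (Mkap j) Pa.
    by rewrite /h 2!starM starK qstar mulrA.
  - case: eqP => _; first by rewrite scaler0 subr0 cnorm1.
    have -> : 1 - 2 *: h j = star (s a) * (1 - 2 *: q (kappa j) a) * s a.
      by rewrite mulrBr mulrBl mulr1 sK // -scalerAr -scalerAl.
    have s1 := cnorm_isometry (sK Pa).
    rewrite !cnormM_le1 ?cnorm_starE //.
    by apply: cnormB_proj2; exact: q_proj.
  apply: (addrI (h i0)); rewrite addr0 [RHS]sqs1.
  rewrite -[RHS](sK Pa) -[in RHS](mulr1 (star _)) -sumq mulr_sumr mulr_suml.
  rewrite [RHS](bigD1 i0) //=; congr (_ + _).
  rewrite [LHS](bigD1 i0) //= eqxx add0r.
  by apply: eq_bigr => j /negPf ->.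
have := h0 i; case: eqP => [ii0|_].
  case: kNa; move: ki ki0; rewrite ii0 invg1 mul1g => -[m Mm mE] [n Mn nE].
  exists (n * m^-1)%g; first by apply: MM => //; exact: MV.
  rewrite -[k]invgK -[k^-1%g](mulgK (kappa i0)) -mE -nE.
  by rewrite !invgM !invgK !mulgA mulgVK.
rewrite /h (q_coset Pa Mk ki) /q => hi.
apply: star_inj; rewrite star0; apply: cnorm_eq0_starM; rewrite starK.
by rewrite !starM starK -hi !mulrA.
Qed.

(** * The span D: commutativity, and stability under products and conjugations *)

Definition range_span b := linear_span [set q k b | k in M].

Local Lemma D_q k b : M k -> P b -> D (q k b).
Proof. by move=> Mk Pb; apply: linear_span_gen; exists k => //; exists b. Qed.

Local Lemma D_range_span b x : P b -> range_span b x -> D x.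
Proof.
move=> Pb; apply: linear_span_sub => [|y z|c y|_ [k Mk <-]].
- exact: linear_span0.
- exact: linear_spanD.
- exact: linear_spanZ.
exact: D_q.
Qed.

(** Insert the partition of unity of level c between s_b and s_b^*. *)
Local Lemma refine_q k b c : M k -> P b -> P c -> range_span (b * c)%g (q k b).
Proof.
move=> Mk Pb Pc; have [I [kappa [Mkap sumq _]]] := partition Pc.
have -> : q k b = \sum_i q (k * (b * kappa i * b^-1))%g (b * c)%g.
  transitivity (u k * (s b * 1 * star (s b)) * star (u k)); first by rewrite mulr1.
  rewrite -sumq !(mulr_sumr, mulr_suml); apply: eq_bigr => i _.
  by rewrite s_q // u_q //; exact: PJ.
apply: linear_span_sum => i; apply: linear_span_gen.
exists (k * (b * kappa i * b^-1))%g => //.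
by apply: MM => //; exact: PJ.
Qed.

Local Lemma q_mul k l b : M k -> M l -> P b ->
  (q l b = q k b) \/ (q k b * q l b = 0).
Proof.
move=> Mk Ml Pb; have [kl|kl] := pselect (conj_set b M (k^-1 * l)%g).
  by left; exact: q_coset.
right; have kM : M k^-1%g by exact: MV.
transitivity (u k * s b * (star (s b) * (star (u k) * u l) * s b) *
    star (s b) * star (u l)); first by rewrite /q !mulrA.
rewrite -uV // -uM // s_u_s //; last exact: MM.
by rewrite mulr0 !mul0r.
Qed.

Local Lemma q_comm k l b : M k -> M l -> P b -> q k b * q l b = q l b * q k b.
Proof.
move=> Mk Ml Pb; have [->//|kl0] := q_mul Mk Ml Pb.
by have [->//|->] := q_mul Ml Mk Pb.
Qed.

(** The levels [range_span b] grow along right multiples, so two generators of D share a level,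
    where [q_mul] governs products. *)
Local Lemma common_range_span k l b c : M k -> M l -> P b -> P c ->
  exists d, [/\ P d, range_span d (q k b) & range_span d (q l c)].
Proof.
move=> Mk Ml Pb Pc; have [b' [c' [Pb' Pc' e]]] := right_multiple Pb Pc.
exists (b * b')%g; split; [exact: PM | exact: refine_q | ].
by rewrite e; exact: refine_q.
Qed.

Local Lemma range_spanM b x y : P b ->
  range_span b x -> range_span b y -> range_span b (x * y).
Proof.
move=> Pb; apply: linear_spanM => _ _ [k Mk <-] [l Ml <-].
have [->|->] := q_mul Mk Ml Pb; last exact: linear_span0.
have [_ ->] := q_proj Mk Pb.
by apply: linear_span_gen; exists k.
Qed.

Local Lemma D_comm x y : D x -> D y -> x * y = y * x.
Proof.
apply: linear_span_comm => _ _ [k Mk [b Pb <-]] [l Ml [c Pc <-]].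
have [d [Pd qd qd']] := common_range_span Mk Ml Pb Pc.
move: qd qd'; apply: linear_span_comm => _ _ [{}k {}Mk <-] [{}l {}Ml <-].
exact: q_comm.
Qed.

Local Lemma D_mul x y : D x -> D y -> D (x * y).
Proof.
apply: linear_spanM => _ _ [k Mk [b Pb <-]] [l Ml [c Pc <-]].
have [d [Pd qd qd']] := common_range_span Mk Ml Pb Pc.
by apply: (D_range_span Pd); exact: range_spanM.
Qed.

Local Lemma D_u k x : M k -> D x -> D (u k * x * star (u k)).
Proof.
move=> Mk; apply: linear_span_sandwich => _ [l Ml [b Pb <-]].
by rewrite u_q //; apply: D_q => //; exact: MM.
Qed.

Local Lemma D_s a x : P a -> D x -> D (s a * x * star (s a)).
Proof.
move=> Pa; apply: linear_span_sandwich => _ [l Ml [b Pb <-]].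
by rewrite s_q //; apply: D_q; [exact: PJ | exact: PM].
Qed.

(** Refined to a level a c, a generator compresses to v e_c v^* with v = s_a^* u(l) s_a; here v =
    u(m) if l = a m a^{-1}, and v = 0 if l is outside M_a. *)
Local Lemma D_star_s a x : P a -> D x -> D (star (s a) * x * s a).
Proof.
move=> Pa; apply: linear_span_sandwich => _ [k Mk [b Pb <-]].
have [c [d [Pc Pd e]]] := right_multiple Pa Pb.
have : range_span (a * c)%g (q k b) by rewrite e; exact: refine_q.
apply: linear_span_sandwich => _ [l Ml <-].
have -> : star (s a) * q l (a * c)%g * s a =
    (star (s a) * u l * s a) * (s c * star (s c)) * star (star (s a) * u l * s a).
  by rewrite /q sM // !starM starK !mulrA.
have [[m Mm <-]|lNa] := pselect (conj_set a M l); last first.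
  by rewrite s_u_s // !mul0r; exact: linear_span0.
have -> : star (s a) * u (a * m * a^-1)%g * s a = u m.
  by rewrite -us // -mulrA sK // mulr1.
exact: D_q.
Qed.

(** * The projections in D: the set F *)

Local Lemma F_e a : P a -> F (s a * star (s a)).
Proof.
have -> : s a * star (s a) = q 1%g a by rewrite /q u1 star1 mulr1 mul1r.
by move=> Pa; split; [apply: q_proj => // | apply: D_q => //]; exact: M1.
Qed.

Local Lemma F1 : F 1.
Proof. by have := F_e P1; rewrite s1 star1 mulr1. Qed.

Local Lemma F0 : F 0.
Proof. by split; [split; rewrite ?star0 ?mulr0 | exact: linear_span0]. Qed.

Local Lemma F_mul f g : F f -> F g -> F (f * g).
Proof.
move=> [[sf ff] Df] [[sg gg] Dg]; split; last exact: D_mul.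
split; first by rewrite starM sf sg; exact: D_comm.
by rewrite mulrA -[f * g * f]mulrA (D_comm Dg Df) mulrA ff -mulrA gg.
Qed.

Local Lemma F_u k f : M k -> F f -> F (u k * f * star (u k)).
Proof.
move=> Mk [pf Df]; split; last exact: D_u.
by apply: isometry_conj_projection => //; exact: uK.
Qed.

Local Lemma F_s a f : P a -> F f -> F (s a * f * star (s a)).
Proof.
move=> Pa [pf Df]; split; last exact: D_s.
by apply: isometry_conj_projection => //; exact: sK.
Qed.

(** Idempotence holds because f commutes with e_a: s_a^* f e_a f s_a = s_a^* e_a f s_a = s_a^* f
    s_a. *)
Local Lemma F_star_s a f : P a -> F f -> F (star (s a) * f * s a).
Proof.
move=> Pa [[sf ff] Df]; split; last exact: D_star_s.
split; first by rewrite !starM starK sf mulrA.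
have [_ De] := F_e Pa.
transitivity (star (s a) * (f * (s a * star (s a)) * f) * s a); first by rewrite !mulrA.
by rewrite (D_comm Df De) -[_ * f * f]mulrA ff !mulrA sK // mul1r.
Qed.

(** * The set T: adjoints, initial projections and products *)

Local Notation T := (T_set H M s u).

Local Lemma T_F f : F f -> T f.
Proof.
move=> Ff; exists 1%g, 1%g, 1%g, 1%g, f; split=> //; first by split; exact: P1.
  by split; exact: M1.
by rewrite s1 u1 star1 !mul1r !mulr1.
Qed.

Local Lemma T_s a : P a -> T (s a).
Proof.
move=> Pa; exists 1%g, a, 1%g, 1%g, 1; split; last by rewrite s1 u1 star1 !mul1r.
- by split=> //; exact: P1.
- by split; exact: M1.
exact: F1.
Qed.

Local Lemma T_u m : M m -> T (u m).
Proof.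
move=> Mm; exists 1%g, 1%g, m, 1%g, 1; split; last first.
- by rewrite s1 u1 star1 mul1r !mulr1.
- exact: F1.
- by split=> //; exact: M1.
by split; exact: P1.
Qed.

Local Lemma T_star t : T t -> T (star t).
Proof.
move=> [a [a' [m [m' [f [[Pa Pa'] [Mm Mm'] Ff ->]]]]]].
exists a', a, m'^-1%g, m^-1%g, f; split=> //; first by split; exact: MV.
by have [[sf _] _] := Ff; rewrite !starM starK sf !uV // !mulrA.
Qed.

(** Makes elements of T partial isometries, and puts every projection p = p^* p of T in F. *)
Local Lemma F_starM t : T t -> F (star t * t).
Proof.
move=> [a [a' [m [m' [f [[Pa Pa'] [Mm Mm'] Ff ->]]]]]].
have [[sf _] _] := Ff.
pose e := u m^-1%g * (s a * star (s a)) * star (u m^-1%g).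
pose g := u m'^-1%g * (f * e * f) * star (u m'^-1%g).
have -> : star (star (s a) * u m * f * u m' * s a') *
    (star (s a) * u m * f * u m' * s a') = star (s a') * g * s a'.
  by rewrite /g /e !starM starK sf !uV // !starK !mulrA.
apply: F_star_s => //; apply: F_u; first exact: MV.
by apply: F_mul => //; apply: F_mul => //; apply: F_u; [exact: MV | exact: F_e].
Qed.

Local Lemma T_mul t t' : T t -> T t' -> T (t * t').
Proof.
move=> [a [a' [m [m' [f [[Pa Pa'] [Mm Mm'] Ff ->]]]]]].
move=> [b [b' [n [n' [g [[Pb Pb'] [Mn Mn'] Fg ->]]]]]].
have [c [d [Pc Pd e]]] := left_multiple Pa' Pb.
pose k := (c * m * c^-1)%g; pose k' := (c * m' * c^-1)%g.
pose l := (d * n * d^-1)%g; pose l' := (d * n' * d^-1)%g.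
have [Mk Mk' Ml Ml'] : [/\ M k, M k', M l & M l'] by split; exact: PJ.
pose E := s (d * b)%g * star (s (d * b)%g).
pose f' := s c * f * star (s c); pose g' := s d * g * star (s d).
(* Between s_(ca)^* and s_(db') the product reads u(k) f' u(k') E u(l) g' u(l'). Moving u(k') and
   u(l) to the right conjugates E by u(k') and g' by u(k' l), and leaves u(k' l l') behind. *)
exists (c * a)%g, (d * b')%g, k, (k' * l * l')%g,
  (f' * (u k' * E * star (u k')) * (u (k' * l)%g * g' * star (u (k' * l)%g))).
split.
- by split; exact: PM.
- by split=> //; apply: MM => //; exact: MM.
- apply: F_mul; last by apply: F_u; [exact: MM | exact: F_s].
  apply: F_mul; first exact: F_s.
  by apply: F_u => //; apply: F_e; exact: PM.
have ss : s a' * star (s b) = star (s c) * E * s d.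
  have -> : E = s d * (s b * star (s b)) * star (s d).
    by rewrite /E sM // starM !mulrA.
  rewrite -!mulrA sK // mulr1 [RHS]mulrA [RHS]mulrA -[_ * s d * s b]mulrA -sM // -e.
  by rewrite sM // mulrA sK // mul1r.
(* Conjugation by s_p passes through the unitaries, replacing x by p x p^{-1}; with s_p^* s_p = 1
   this carries s_c^* leftward and s_d rightward. *)
have push p (x y : G) h : P p -> M x -> M y ->
    s p * (u x * h * u y) * star (s p) =
    u (p * x * p^-1)%g * (s p * h * star (s p)) * u (p * y * p^-1)%g.
  move=> Pp Mx My; rewrite !mulrA su // -!mulrA us //.
have pushl p X : P p -> X * star (s p) = star (s p) * (s p * X * star (s p)).
  by move=> Pp; rewrite !mulrA sK // mul1r.
have pushr p X : P p -> s p * X = s p * X * star (s p) * s p.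
  by move=> Pp; rewrite -mulrA sK // mulr1.
transitivity (star (s a) * ((u m * f * u m') * star (s c)) * E *
    (s d * (u n * g * u n')) * s b').
  transitivity (star (s a) * (u m * f * u m') * (s a' * star (s b)) *
    (u n * g * u n') * s b'); first by rewrite !mulrA.
  by rewrite ss !mulrA.
rewrite pushl // (pushr d) // !push // -/k -/k' -/l -/l' -/f' -/g'.
clearbody k k' l l' f' g' E.
rewrite !sM // starM !uM //; last exact: MM.
rewrite starM !mulrA.
have cancel x X : M x -> X * star (u x) * u x = X.
  by move=> Mx; rewrite -mulrA uK // mulr1.
by rewrite !cancel.
Qed.

End Algebra.

(** * Closures of *-subalgebras, and density *)

Section Closure.
Variables (R : realType) (A : cstarAlgType R).
Implicit Types S B : set A.
Local Notation cl S := (closure (S : set (normed_space A)) : set A).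

Lemma closure_cnormP S x :
  cl S x <-> forall e : R[i], 0 < e -> exists2 y, S y & cnorm (x - y) < e.
Proof.
split=> [clx e e0|clx U /nbhs_normP[e /= e0 eU]].
  have [y [Sy xy]] := clx _ (@nbhsx_ballx _ (normed_space A) x e e0).
  by exists y => //; move: xy; rewrite -ball_normE.
have [y Sy xy] := clx _ e0; exists y; split=> //.
exact: eU.
Qed.

(** The image of S need only lie in the closure of S', so that a binary operation can be treated one
    variable at a time. *)
Lemma closure_lipschitz S S' (f : A -> A) (k : R[i]) : 0 <= k ->
  (forall x y, cnorm (f x - f y) <= k * cnorm (x - y)) ->
  (forall x, S x -> cl S' (f x)) -> forall x, cl S x -> cl S' (f x).
Proof.
move=> k0 fk fS x /closure_cnormP clx; apply/closure_cnormP => e e0.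
(* Dividing by k + 1 rather than k covers k = 0. *)
have k1 : 0 < k + 1 by rewrite ltr_wpDl.
have [y Sy xy] := clx (e / 2 / (k + 1)) (divr_gt0 (divr_gt0 e0 (ltr0n _ 2)) k1).
have [z S'z yz] := (closure_cnormP _ _).1 (fS y Sy) _ (divr_gt0 e0 (ltr0n _ 2)).
exists z => //; rewrite -(subrKA (f y)) (le_lt_trans (cnormD _ _)) //.
rewrite [ltRHS]splitr ler_ltD // (le_trans (fk _ _)) //.
move: xy; rewrite ltr_pdivlMr // => /ltW; apply: le_trans.
by rewrite mulrC ler_wpM2l ?cnorm_ge0 // lerDl.
Qed.

Lemma closure_star_subalgebra S : is_star_subalgebra S ->
  is_star_subalgebra (cl S).
Proof.
move=> [S0 SD SZ SM Sstar]; have sub x : S x -> cl S x by exact: subset_closure.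
have lipD (a x y : A) : cnorm (a + x - (a + y)) <= 1 * cnorm (x - y).
  by rewrite opprD addrACA subrr add0r mul1r.
have lipM (a x y : A) : cnorm (a * x - a * y) <= cnorm a * cnorm (x - y).
  by rewrite -mulrBr cnormM.
have lipMr (a x y : A) : cnorm (x * a - y * a) <= cnorm a * cnorm (x - y).
  by rewrite -mulrBl [leRHS]mulrC cnormM.
have lipZ c (x y : A) : cnorm (c *: x - c *: y) <= `|c| * cnorm (x - y).
  by rewrite -scalerBr cnormZ.
have lipstar (x y : A) : cnorm (star x - star y) <= 1 * cnorm (x - y).
  by rewrite -starN -starD cnorm_starE mul1r.
split=> [|x y clx|c|x y clx|].
- exact: sub.
- apply: closure_lipschitz ler01 (lipD x) _ _ => {}y Sy.
  rewrite addrC; apply: closure_lipschitz ler01 (lipD y) _ _ clx => {}x Sx.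
  by apply: sub; exact: SD.
- apply: closure_lipschitz (normr_ge0 _) (lipZ c) _ => x Sx.
  by apply: sub; exact: SZ.
- apply: closure_lipschitz (cnorm_ge0 x) (lipM x) _ _ => {}y Sy.
  apply: closure_lipschitz (cnorm_ge0 y) (lipMr y) _ _ clx => {}x Sx.
  by apply: sub; exact: SM.
apply: closure_lipschitz ler01 lipstar _ => x Sx.
by apply: sub; exact: Sstar.
Qed.

(** The closure of B is a closed *-subalgebra containing the generators, hence everything. *)
Lemma cstar_generated_dense S B : cstar_generated S -> is_star_subalgebra B ->
  S `<=` B -> dense (B : set (normed_space A)).
Proof.
move=> gen subB SB O [x Ox] oO.
have BT : cl B = setT.
  apply: gen; first exact: closure_star_subalgebra.
    exact: closed_closure.
  by apply: subset_trans SB _; exact: (@subset_closure (normed_space A)).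
have : cl B x by rewrite BT.
move=> /(_ O); rewrite setIC; apply; exact: open_nbhs_nbhs.
Qed.

End Closure.

(** * The inverse semigroup T, its projections and its dense span *)

Theorem proposition3p5 (R : realType) (G : groupType) (N H M : set G)
  (hG : is_semidirect N H)
  (hM : is_normal_subgroup M N)
  (hHr : H = [set (a * b^-1)%g | a in contractors H M & b in contractors H M])
  (hHl : H = [set (a^-1 * b)%g | a in contractors H M & b in contractors H M])
  (hfin : forall a, contractors H M a -> finite_index M (conj_set a M))
  (hcap : \bigcap_(a in contractors H M) conj_set a M = [set 1%g])
  (A : cstarAlgType R) (s u : G -> A) (hA : is_universal H M s u) :
  [/\ is_inverse_semigroup (T_set H M s u),
      T_set H M s u 0,
      T_set H M s u `&` [set p | is_projection p] = F_proj H M s u,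
      is_star_subalgebra (linear_span (T_set H M s u))
    & dense (linear_span (T_set H M s u) : set (normed_space A))].
Proof.
have [_ subH _ _] := hG; have [subM _ _] := hM; have [rel gen _] := hA.
have Tmul := T_mul subH subM hHr hHl hfin rel.
have Tstar := T_star subM rel.
have FT := T_F subH subM rel.
have TF := F_starM subH subM hHr hfin rel.
have subT := linear_span_star_subalgebra Tmul Tstar.
split=> //.
- by split=> // x /TF[].
- exact/FT/F0.
- apply/seteqP; split=> [p [Tp [sp pp]]|f Ff]; first by rewrite -pp -{1}sp; exact: TF.
  by split; [exact: FT | case: Ff].
apply: cstar_generated_dense gen subT _ => x; case=> [[a Pa <-]|[m Mm <-]].
  exact/linear_span_gen/(T_s subH subM rel).
exact/linear_span_gen/(T_u subH subM rel).
Qed.
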